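(* Let $g:\{0,1\}^n\to\{0,1\}$ be a monotone non-trivial Boolean function that is not a dictator. Then the map $p\mapsto\mathbb E_p[g]$ has a fixed point in $(0,1)$ if and only if $$\frac{d}{dp}\mathbb E_p[g]\Big|_{p=0}=\frac{d}{dp}\mathbb E_p[g]\Big|_{p=1}=0 .$$ Furthermore, in this case the fixed point $p_\circ\in(0,1)$ is unique and $\frac{d}{dp}\mathbb E_p[g]\big|_{p=p_\circ}>1$.
   Context: $\mathbb E_p$ is expectation when the coordinates of $\omega\in\{0,1\}^n$ are i.i.d. Bernoulli($p$), $p\in[0,1]$. Monotone means non-decreasing in each coordinate. Non-trivial means $g(0,\dots,0)=0$ and $g(1,\dots,1)=1$. A dictator is a function of the form $g(\omega)=\omega_i$ for some fixed $i\in\{1,\dots,n\}$. *)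

(* Defs.v *)
From mathcomp Require Import all_boot all_order all_algebra.
From mathcomp Require Import all_classical all_reals all_analysis.

Set Implicit Arguments.
Unset Strict Implicit.
Unset Printing Implicit Defensive.

Import Order.TTheory GRing.Theory Num.Theory.
Import numFieldNormedType.Exports.

Local Open Scope ring_scope.

Definition cube (n : nat) := {ffun 'I_n -> bool}.

Definition bfun (n : nat) := cube n -> bool.

Definition monotone_bfun (n : nat) (g : bfun n) : Prop :=
  forall (i : 'I_n) (w w' : cube n),
    (forall j, j != i -> w j = w' j) -> (w i <= w' i)%N -> (g w <= g w')%N.

Definition nontrivial_bfun (n : nat) (g : bfun n) : Prop :=
  g [ffun=> false] = false /\ g [ffun=> true] = true.

Definition dictator (n : nat) (g : bfun n) : Prop :=
  exists i : 'I_n, forall w : cube n, g w = w i.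

(* [bernoulli_pmf p b] is [p] if [b] and [1 - p] otherwise.  The library has no
   finite product of measures, so the expectation is written out as a sum over
   the finite sample space. *)
Definition product_pmf (R : realType) (n : nat) (p : R) (w : cube n) : R :=
  \prod_(i < n) bernoulli_pmf p (w i).

Definition expectation_p (R : realType) (n : nat) (f : cube n -> R) (p : R) : R :=
  \sum_(w : cube n) product_pmf p w * f w.

(* [expectation_of g] is probabilistically meaningful on [0, 1] only.  The same
   formula, a polynomial in [p], extends it to all of [R], so that its ordinary
   derivative at 0 and 1 exists (see [derivable_expectation_of]) and agrees
   with the one-sided derivative of the restriction to [0, 1]. *)
Definition expectation_of (R : realType) (n : nat) (g : bfun n) : R -> R :=
  expectation_p (fun w => (g w)%:R).

Definition interior_fixed_point (R : realType) (f : R -> R) (p : R) : Prop :=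
  0 < p < 1 /\ f p = p.

Lemma product_pmf_sum1 (R : realType) (n : nat) (p : R) :
  \sum_(w : cube n) product_pmf p w = 1.
Proof.
rewrite /product_pmf -(bigA_distr_bigA (fun _ => bernoulli_pmf p)) big1 // => i _.
by rewrite big_bool /= /bernoulli_pmf addrC subrK.
Qed.

Lemma derivable_expectation_of (R : realType) (n : nat) (g : bfun n) (p : R) :
  derivable (expectation_of g : R -> R) p 1.
Proof.
pose P : {poly R} := \sum_(w : cube n)
  (\prod_(i < n) (if w i then 'X else 1 - 'X)) * (g w)%:R%:P.
suff -> : expectation_of g = horner P by exact: derivable_horner.
apply/funext => q; rewrite /P horner_sum; apply: eq_bigr => w _.
rewrite hornerM hornerC horner_prod; congr (_ * _).
by apply: eq_bigr => i _; rewrite /bernoulli_pmf; case: (w i); rewrite !hornerE.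
Qed.

(* Main.v *)
Require Import Defs.
From mathcomp Require Import all_boot all_order all_algebra.
From mathcomp Require Import all_classical all_reals all_analysis.
From mathcomp Require Import ring lra.
Import Order.TTheory GRing.Theory Num.Theory.
Import numFieldNormedType.Exports.
Local Open Scope ring_scope.

(** Write h(p) for E_p[g].  The engine is the Moore-Shannon inequality: for
    monotone g and 0 < p < 1,

      p (1 - p) h'(p) >= h(p) (1 - h(p)),

    that is, the variance of g is at most p (1 - p) times its total influence,
    with equality only when g is constant or a dictator.  It is proved by
    conditioning on one coordinate.  If h_0 and h_1 belong to the two
    restrictions of g, then h = (1 - p) h_0 + p h_1, and the gap between the two
    sides of the inequality satisfies ([poincare_gap_cons])

      gap(h) = (1 - p) gap(h_0) + p gap(h_1) + p (1 - p) d (1 - d),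

    where d = h_1 - h_0 lies in [0, 1] because g is monotone.  All terms are
    nonnegative, and if they all vanish then d is 0 or 1: for d = 0 the
    coordinate is irrelevant and induction applies, for d = 1 the function g is
    that coordinate ([poincare_gap_ge0], [poincare_gap_eq0]).

    At a fixed point p of h in (0, 1) the strict inequality reads h'(p) > 1.
    It also says that the odds ratio h (1 - p) / ((1 - h) p) has a positive
    derivative on (0, 1).  Interior fixed points are the points where this
    ratio is 1, so there is at most one ([interior_fixed_point_unique]).

    The endpoint derivatives are counted by the Margulis-Russo formula: h'(0) is
    the number of i such that g = 1 at the configuration with a single one, at
    i.  If there is such an i, then g >= w_i by monotonicity, and since g is not
    a dictator h(p) > p on (0, 1); so an interior fixed point forces h'(0) = 0,
    and symmetrically h'(1) = 0.  Conversely h is a polynomial with h(0) = 0 and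
    h(1) = 1, so h(p) - p = p (p - 1) Q(p) for a polynomial Q, and
    h'(0) = h'(1) = 0 means Q(0) = 1 and Q(1) = -1: the intermediate value
    theorem gives a root of Q in (0, 1) ([exists_fixed_point_horner]). *)

(** * Splitting off the first coordinate of the cube *)

Definition cube_cons {n : nat} (b : bool) (w : cube n) : cube n.+1 :=
  [ffun i => if unlift ord0 i is Some j then w j else b].

Definition cube_tail {n : nat} (w : cube n.+1) : cube n :=
  [ffun j => w (lift ord0 j)].

Definition set_coord {n : nat} (i : 'I_n) (b : bool) (w : cube n) : cube n :=
  [ffun j => if j == i then b else w j].

Lemma cube_consK {n : nat} (w : cube n.+1) :
  cube_cons (w ord0) (cube_tail w) = w.
Proof.
by apply/ffunP => i; rewrite ffunE; case: unliftP => [j|] -> //; rewrite ffunE.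
Qed.

Lemma cube_cons0 {n : nat} (b : bool) (w : cube n) : cube_cons b w ord0 = b.
Proof. by rewrite ffunE unlift_none. Qed.

Lemma cube_consS {n : nat} (b : bool) (w : cube n) (j : 'I_n) :
  cube_cons b w (lift ord0 j) = w j.
Proof. by rewrite ffunE liftK. Qed.

Lemma cube_tailK {n : nat} (b : bool) (w : cube n) :
  cube_tail (cube_cons b w) = w.
Proof. by apply/ffunP => j; rewrite ffunE cube_consS. Qed.

Lemma cube_cons_cst {n : nat} (b : bool) :
  cube_cons b [ffun=> b] = [ffun=> b] :> cube n.+1.
Proof. by apply/ffunP => i; rewrite !ffunE; case: unlift => // j; rewrite ffunE. Qed.

Lemma set_coord_cons0 {n : nat} (b c : bool) (w : cube n) :
  set_coord ord0 b (cube_cons c w) = cube_cons b w.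
Proof.
by apply/ffunP => i; rewrite !ffunE; case: unliftP => [j|] ->; rewrite ?eqxx.
Qed.

Lemma set_coord_consS {n : nat} (j : 'I_n) (b c : bool) (w : cube n) :
  set_coord (lift ord0 j) b (cube_cons c w) = cube_cons c (set_coord j b w).
Proof.
apply/ffunP => i; rewrite !ffunE; case: unliftP => [k|] -> //.
by rewrite (inj_eq lift_inj) ffunE.
Qed.

Lemma sum_cube_cons {V : nmodType} {n : nat} (F : cube n.+1 -> V) :
  \sum_(w : cube n.+1) F w =
  \sum_(w : cube n) F (cube_cons false w) + \sum_(w : cube n) F (cube_cons true w).
Proof.
rewrite addrC -(big_bool _ (fun b => \sum_w F (cube_cons b w))) /= pair_big /=.
rewrite (reindex (fun q : bool * cube n => cube_cons q.1 q.2)) //=.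
exists (fun w : cube n.+1 => (w ord0, cube_tail w)) => [[b w] _|w _] /=.
  by rewrite cube_cons0 cube_tailK.
exact: cube_consK.
Qed.

(** * The expectation as a function of p *)

Lemma product_pmf_cons {R : realType} {n : nat} (p : R) (b : bool) (w : cube n) :
  product_pmf p (cube_cons b w) = bernoulli_pmf p b * product_pmf p w.
Proof.
rewrite /product_pmf big_ord_recl cube_cons0; congr (_ * _).
by apply: eq_bigr => i _; rewrite cube_consS.
Qed.

(** Law of total expectation over the first coordinate; the inductions on the
    dimension for expectations, derivatives and gaps all rest on it. *)
Lemma expectation_cons {R : realType} {n : nat} (f : cube n.+1 -> R) (p : R) :
  expectation_p f p = (1 - p) * expectation_p (f \o cube_cons false) p
                      + p * expectation_p (f \o cube_cons true) p.
Proof.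
rewrite /expectation_p sum_cube_cons !big_distrr.
by congr (_ + _); apply: eq_bigr => w _; rewrite product_pmf_cons -mulrA.
Qed.

Lemma eq_expectation {R : realType} {n : nat} (f f' : cube n -> R) (p : R) :
  f =1 f' -> expectation_p f p = expectation_p f' p.
Proof. by move=> eqf; apply: eq_bigr => w _; rewrite eqf. Qed.

Lemma expectation_cst {R : realType} {n : nat} (c p : R) :
  expectation_p (fun _ : cube n => c) p = c.
Proof. by rewrite /expectation_p -big_distrl /= product_pmf_sum1 mul1r. Qed.

Lemma expectation_cube0 {R : realType} (f : cube 0 -> R) :
  expectation_p f = cst (f [ffun=> false]).
Proof.
apply/funext => p; rewrite -[RHS](@expectation_cst R 0 _ p).
by apply: eq_expectation => w; congr f; apply/ffunP; case.
Qed.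

Lemma expectation_coord {R : realType} {n : nat} (i : 'I_n) (p : R) :
  expectation_p (fun w : cube n => (w i)%:R) p = p.
Proof.
elim: n i => [|n IHn] i; first by case: i.
rewrite expectation_cons; case: (unliftP ord0 i) => [j|] ->.
  rewrite !(@eq_expectation _ _ (_ \o _) (fun w => (w j)%:R)) ?IHn.
  - by ring.
  - by move=> w /=; rewrite cube_consS.
  - by move=> w /=; rewrite cube_consS.
rewrite (@eq_expectation _ _ (_ \o _) (fun=> 0)); last first.
  by move=> w /=; rewrite cube_cons0.
rewrite (@eq_expectation _ _ (_ \o _) (fun=> 1)); last first.
  by move=> w /=; rewrite cube_cons0.
by rewrite !expectation_cst; ring.
Qed.

(** For p = 0 or p = 1 the product measure is a point mass. *)
Lemma expectation_endpoint {R : realType} {n : nat} (f : cube n -> R) (b : bool) :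
  expectation_p f b%:R = f [ffun=> b].
Proof.
elim: n f => [|n IHn] f.
  by rewrite expectation_cube0 /=; congr f; apply/ffunP; case.
by rewrite expectation_cons !IHn -cube_cons_cst /=; case: (b) => /=; ring.
Qed.

Lemma expectation_polynomial {R : realType} {n : nat} (f : cube n -> R) :
  exists P : {poly R}, expectation_p f = horner P.
Proof.
elim: n f => [|n IHn] f.
  by exists (f [ffun=> false])%:P; rewrite expectation_cube0 hornerC_ext.
have [P0 P0E] := IHn (f \o cube_cons false).
have [P1 P1E] := IHn (f \o cube_cons true).
exists ((1 - 'X) * P0 + 'X * P1); apply/funext => p.
by rewrite expectation_cons P0E P1E !hornerE.
Qed.

(** Stated for the genuine derivative but computed on polynomials, where it is
    the Leibniz rule applied to the law of total expectation. *)
Lemma derive_expectation_cons {R : realType} {n : nat} (f : cube n.+1 -> R) (p : R) :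
  derive1 (expectation_p f) p =
    expectation_p (f \o cube_cons true) p - expectation_p (f \o cube_cons false) p
    + (1 - p) * derive1 (expectation_p (f \o cube_cons false)) p
    + p * derive1 (expectation_p (f \o cube_cons true)) p.
Proof.
have [P0 P0E] := expectation_polynomial (f \o cube_cons false).
have [P1 P1E] := expectation_polynomial (f \o cube_cons true).
have -> : expectation_p f = horner ((1 - 'X) * P0 + 'X * P1).
  by apply/funext => q; rewrite expectation_cons P0E P1E !hornerE.
rewrite P0E P1E -!derivE !derivD !derivM !derivB !derivX !derivC !hornerE /=.
by ring.
Qed.

(** Margulis-Russo formula.  The first coordinate contributes the difference of
    the two restrictions produced by the Leibniz rule; the other coordinates
    come from the induction hypothesis for each restriction. *)
Lemma margulis_russo {R : realType} {n : nat} (f : cube n -> R) (p : R) :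
  derive1 (expectation_p f) p =
    \sum_(i < n)
      (expectation_p (f \o set_coord i true) p
       - expectation_p (f \o set_coord i false) p).
Proof.
elim: n f => [|n IHn] f.
  by rewrite big_ord0 expectation_cube0 derive1_cst.
rewrite derive_expectation_cons big_ord_recl !IHn -addrA; congr (_ + _).
  have E0 b c : f \o set_coord ord0 b \o cube_cons c = f \o cube_cons b.
    by apply/funext => w /=; rewrite set_coord_cons0.
  by rewrite !expectation_cons !E0; ring.
rewrite !big_distrr -big_split /=; apply: eq_bigr => i _.
have ES b c : f \o set_coord (lift ord0 i) b \o cube_cons c
    = f \o cube_cons c \o set_coord i b.
  by apply/funext => w /=; rewrite set_coord_consS.
by rewrite !expectation_cons !ES; ring.
Qed.

(** * Monotonicity *)

Lemma product_pmf_gt0 {R : realType} {n : nat} (p : R) (w : cube n) :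
  0 < p < 1 -> 0 < product_pmf p w.
Proof.
case/andP => p0 p1; apply: prodr_gt0 => i _.
by rewrite /bernoulli_pmf; case: (w i); rewrite ?subr_gt0.
Qed.

Lemma le_expectation {R : realType} {n : nat} (f f' : cube n -> R) (p : R) :
  0 < p < 1 -> (forall w, f w <= f' w) -> expectation_p f p <= expectation_p f' p.
Proof.
by move=> p01 le_ff'; apply: ler_sum => w _; rewrite ler_pM2l ?product_pmf_gt0.
Qed.

(** For 0 < p < 1 every configuration has positive mass, so the expectation is
    strictly increasing in the function: this turns an equality of numbers
    between comparable functions into an equality of functions. *)
Lemma expectation_inj_le {R : realType} {n : nat} (f f' : cube n -> R) (p : R) :
  0 < p < 1 -> (forall w, f w <= f' w) ->
  expectation_p f p = expectation_p f' p -> f =1 f'.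
Proof.
move=> p01 le_ff' Eff' w.
have pos v : true -> 0 <= product_pmf p v * (f' v - f v).
  by move=> _; rewrite mulr_ge0 ?subr_ge0 // ltW ?product_pmf_gt0.
have sum0 : \sum_v product_pmf p v * (f' v - f v) = 0.
  under eq_bigr => v _ do rewrite mulrBr.
  by rewrite sumrB -[X in X - _]Eff' subrr.
have /eqP := psumr_eq0P pos sum0 (isT : true) (i := w).
by rewrite mulf_eq0 gt_eqF ?product_pmf_gt0 //= subr_eq0 => /eqP.
Qed.

Lemma monotone_cons {n : nat} (g : bfun n.+1) (b : bool) :
  monotone_bfun g -> monotone_bfun (g \o cube_cons b).
Proof.
move=> mg i w w' eqw lew; apply: (mg (lift ord0 i)); last by rewrite !cube_consS.
move=> j; case: (unliftP ord0 j) => [k|] ->; last by rewrite !cube_cons0.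
by rewrite (inj_eq lift_inj) !cube_consS; apply: eqw.
Qed.

(** The definition of monotonicity only compares configurations that differ in
    one coordinate; a general pair is joined by changing the coordinates one at
    a time. *)
Lemma monotone_le {n : nat} (g : bfun n) (w w' : cube n) :
  monotone_bfun g -> (forall i, w i ==> w' i) -> g w ==> g w'.
Proof.
elim: n g w w' => [|n IHn] g w w' mg le_ww'.
  by rewrite (_ : w = w') ?implybb //; apply/ffunP; case.
have := IHn _ (cube_tail w) (cube_tail w') (monotone_cons g (w ord0) mg).
rewrite /= cube_consK => le1; apply/implyP => gw.
have /(implyP (le1 _)) : g w := gw.
have le2 : (g (cube_cons (w ord0) (cube_tail w')) <= g w')%N.
  apply: (mg ord0) => [j|].
    case: (unliftP ord0 j) => [k|] ->; last by rewrite eqxx.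
    by rewrite cube_consS ffunE.
  by rewrite cube_cons0; have := le_ww' ord0; case: (w _); case: (w' _).
move=> h; move: le2; rewrite h; first by case: (g w').
by move=> j; rewrite !ffunE.
Qed.

(** * The Moore-Shannon inequality *)

(** The Poincare inequality for a Boolean function with expectation F(p) under
    the product measure, as a difference: by the Margulis-Russo formula F'(p) is
    the total influence, and F(p) (1 - F(p)) is the variance. *)
Definition poincare_gap {R : realType} (F : R -> R) (p : R) : R :=
  p * (1 - p) * derive1 F p - F p * (1 - F p).

(** The variance of g is the average of the conditional variances plus
    p (1 - p) d^2, and the derivative of the expectation is the average of the
    conditional ones plus d; the last term is the difference
    p (1 - p) (d - d^2). *)
Lemma poincare_gap_cons {R : realType} {n : nat} (g : bfun n.+1) (p : R) :
  let E0 := expectation_of (g \o cube_cons false) in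
  let E1 := expectation_of (g \o cube_cons true) in
  poincare_gap (expectation_of g) p =
    (1 - p) * poincare_gap E0 p + p * poincare_gap E1 p
    + p * (1 - p) * ((E1 p - E0 p) * (1 - (E1 p - E0 p))).
Proof.
move=> E0 E1; rewrite /poincare_gap.
have -> : derive1 (expectation_of g) p =
    E1 p - E0 p + (1 - p) * derive1 E0 p + p * derive1 E1 p.
  exact: derive_expectation_cons.
have -> : expectation_of g p = (1 - p) * E0 p + p * E1 p by exact: expectation_cons.
by ring.
Qed.

Lemma expectation_of_itv {R : realType} {n : nat} (g : bfun n) (p : R) :
  0 < p < 1 -> 0 <= expectation_of g p <= 1.
Proof.
move=> p01; rewrite -[X in X <= _](@expectation_cst R n 0 p).
rewrite -[X in _ && (_ <= X)](@expectation_cst R n 1 p).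
by rewrite !le_expectation // => w; case: (g w); rewrite ?ler01.
Qed.

Lemma expectation_of_cons_le {R : realType} {n : nat} (g : bfun n.+1) (p : R) :
  monotone_bfun g -> 0 < p < 1 ->
  expectation_of (g \o cube_cons false) p <= expectation_of (g \o cube_cons true) p.
Proof.
move=> mg p01; apply: le_expectation => // w; rewrite ler_nat /=.
apply: (mg ord0) => [j|]; last by rewrite !cube_cons0.
by case: (unliftP ord0 j) => [k|] ->; rewrite ?eqxx // !cube_consS.
Qed.

Lemma expectation_of_inj {R : realType} {n : nat} (g g' : bfun n) (p : R) :
  0 < p < 1 -> (forall w, g w ==> g' w) ->
  expectation_of g p = expectation_of g' p -> g =1 g'.
Proof.
move=> p01 le_gg' /(expectation_inj_le _ _ _ p01) eqf w.
have /eqP : (g w)%:R = (g' w)%:R :> R.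
  by apply: eqf => v; rewrite ler_nat; have := le_gg' v; case: (g v); case: (g' v).
by rewrite eqr_nat; case: (g w); case: (g' w).
Qed.

Lemma poincare_gap_ge0 {R : realType} {n : nat} (g : bfun n) (p : R) :
  monotone_bfun g -> 0 < p < 1 -> 0 <= poincare_gap (expectation_of g) p.
Proof.
elim: n g => [|n IHn] g mg p01.
  rewrite /poincare_gap /expectation_of expectation_cube0 derive1_cst /=.
  by case: (g _); rewrite ?subrr ?mul0r ?mulr0 subr0.
have /andP[p0 p1] := p01.
rewrite poincare_gap_cons /=.
have := expectation_of_cons_le _ _ mg p01.
have := expectation_of_itv (g \o cube_cons true) _ p01.
have := expectation_of_itv (g \o cube_cons false) _ p01.
have := IHn _ (monotone_cons g true mg) p01.
have := IHn _ (monotone_cons g false mg) p01.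
move=> gap0 gap1 /andP[E00 E01] /andP[E10 E11] le01.
by rewrite !addr_ge0 ?mulr_ge0 //; lra.
Qed.

(** The three nonnegative terms of [poincare_gap_cons] vanish.  Either both
    restrictions of g have the same expectation and then coincide, so that the
    induction hypothesis for one of them settles g, or the expectations are 0
    and 1 and g is its first coordinate. *)
Lemma poincare_gap_eq0 {R : realType} {n : nat} (g : bfun n) (p : R) :
  monotone_bfun g -> 0 < p < 1 -> poincare_gap (expectation_of g) p = 0 ->
  (exists b, forall w, g w = b) \/ dictator g.
Proof.
elim: n g => [|n IHn] g mg p01.
  move=> _; left; exists (g [ffun=> false]) => w.
  by congr g; apply/ffunP; case.
have /andP[p0 p1] := p01.
rewrite poincare_gap_cons /=.
set g0 := g \o cube_cons false; set g1 := g \o cube_cons true.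
have mg0 : monotone_bfun g0 := monotone_cons g false mg.
have mg1 : monotone_bfun g1 := monotone_cons g true mg.
have le01 := expectation_of_cons_le _ _ mg p01; rewrite -/g0 -/g1 in le01.
have := expectation_of_itv g1 _ p01; have := expectation_of_itv g0 _ p01.
have := poincare_gap_ge0 _ _ mg1 p01; have gap0 := poincare_gap_ge0 _ _ mg0 p01.
move=> gap1 /andP[E00 E01] /andP[E10 E11].
have q0 : 0 < 1 - p by rewrite subr_gt0.
set d := expectation_of g1 p - expectation_of g0 p.
have t0 : 0 <= (1 - p) * poincare_gap (expectation_of g0) p.
  by apply: mulr_ge0 => //; exact: ltW.
have t1 : 0 <= p * poincare_gap (expectation_of g1) p.
  by apply: mulr_ge0 => //; exact: ltW.
have t2 : 0 <= p * (1 - p) * (d * (1 - d)).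
  have d0 : 0 <= d by rewrite subr_ge0.
  have d1 : 0 <= 1 - d by rewrite /d; lra.
  by rewrite !mulr_ge0 // ltW.
move=> sum0.
have : p * (1 - p) * (d * (1 - d)) = 0 by lra.
have gap00 : poincare_gap (expectation_of g0) p = 0.
  have /eqP : (1 - p) * poincare_gap (expectation_of g0) p = 0 by lra.
  by rewrite mulf_eq0 gt_eqF //= => /eqP.
move/eqP; rewrite !mulf_eq0 (gt_eqF p0) (gt_eqF q0) /= subr_eq0.
move=> /orP[/eqP d0|/eqP d1].
  have g01 : g0 =1 g1.
    apply: (expectation_of_inj _ _ _ p01) => [w|]; last by move: d0; rewrite /d; lra.
    apply: (monotone_le g (cube_cons false w) (cube_cons true w) mg) => i.
    rewrite !ffunE; case: (unlift _ _) => // j.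
    exact: implybb.
  have tailE w : g w = g0 (cube_tail w).
    by rewrite -{1}(cube_consK w); case: (w ord0) => //; rewrite g01.
  case: (IHn g0 mg0 p01 gap00) => [[b gb]|[i gi]].
    by left; exists b => w; rewrite tailE gb.
  by right; exists (lift ord0 i) => w; rewrite tailE gi ffunE.
have g0E : (fun=> false) =1 g0.
  apply: (expectation_of_inj _ _ _ p01) => //.
  by rewrite [LHS]/expectation_of expectation_cst mulr0n; move: d1; rewrite /d; lra.
have g1E : g1 =1 (fun=> true).
  apply: (expectation_of_inj _ _ _ p01) => [w|]; first exact: implybT.
  by rewrite [RHS]/expectation_of expectation_cst mulr1n; move: d1; rewrite /d; lra.
right; exists ord0 => w; rewrite -{1}(cube_consK w).
by case: (w ord0); [exact: g1E|rewrite -[LHS]g0E].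
Qed.

Lemma poincare_gap_gt0 {R : realType} {n : nat} (g : bfun n) (p : R) :
  monotone_bfun g -> nontrivial_bfun g -> ~ dictator g -> 0 < p < 1 ->
  0 < poincare_gap (expectation_of g) p.
Proof.
move=> mg [g0 g1] ndict p01; rewrite lt0r poincare_gap_ge0 // andbT.
apply/eqP => /(poincare_gap_eq0 _ _ mg p01)[[b gb]|//].
by move: g0 g1; rewrite !gb => ->.
Qed.

(** * Interior fixed points and the endpoint derivatives *)

Lemma expectation_of_oo {R : realType} {n : nat} (g : bfun n) (p : R) :
  nontrivial_bfun g -> 0 < p < 1 -> 0 < expectation_of g p < 1.
Proof.
move=> [g0 g1] p01; have /andP[E0 E1] := expectation_of_itv g _ p01.
rewrite !lt_neqAle E0 E1 !andbT; apply/andP; split; apply/eqP => Eg.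
  have : (fun=> false) =1 g.
    apply: (expectation_of_inj _ _ _ p01) => //.
    by rewrite -Eg /expectation_of expectation_cst.
  by move/(_ [ffun=> true]); rewrite g1.
have : g =1 (fun=> true).
  apply: (expectation_of_inj _ _ _ p01) => [w|]; first exact: implybT.
  by rewrite Eg /expectation_of expectation_cst.
by move/(_ [ffun=> false]); rewrite g0.
Qed.

(** The coordinate w_i has expectation p, so a fixed point would make g and w_i
    comparable functions with equal expectations, hence equal. *)
Lemma no_fixed_point_comparable {R : realType} {n : nat}
    (g : bfun n) (i : 'I_n) (p : R) :
  ~ dictator g ->
  (forall w : cube n, w i ==> g w) \/ (forall w : cube n, g w ==> w i) ->
  ~ interior_fixed_point (expectation_of g) p.
Proof.
move=> ndict cmp [p01 Ep]; apply: ndict; exists i => w.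
have Ei : expectation_of (fun w : cube n => w i) p = p := expectation_coord i p.
case: cmp => cmp; last first.
  by apply: (expectation_of_inj _ (fun w : cube n => w i) _ p01); rewrite ?Ep ?Ei.
apply/esym.
by apply: (expectation_of_inj (fun w : cube n => w i) _ _ p01); rewrite ?Ep ?Ei.
Qed.

(** A nonzero term of the Margulis-Russo sum at 0 is a coordinate whose single
    one already makes g equal to 1, so that g dominates this coordinate. *)
Lemma derive_at0_fixed_point {R : realType} {n : nat} (g : bfun n) (p : R) :
  monotone_bfun g -> g [ffun=> false] = false -> ~ dictator g ->
  interior_fixed_point (expectation_of g) p ->
  derive1 (expectation_of g : R -> R) 0 = 0.
Proof.
move=> mg g0 ndict fixp; rewrite margulis_russo big1 // => i _.
rewrite -[0 : R]/((false : nat)%:R) !expectation_endpoint /=.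
have -> : set_coord i false [ffun=> false] = [ffun=> false].
  by apply/ffunP => j; rewrite !ffunE if_same.
rewrite g0; case gi : (g _); last by rewrite subrr.
case: (no_fixed_point_comparable g i p ndict _ fixp); left => w.
apply/implyP => wi; have := monotone_le g _ w mg.
move/(_ (set_coord i true [ffun=> false])).
rewrite gi; apply=> j; rewrite !ffunE; case: eqP => // ->.
by rewrite wi.
Qed.

(** Dually, a nonzero term at 1 is a coordinate whose single zero makes g equal
    to 0, so that g is dominated by this coordinate. *)
Lemma derive_at1_fixed_point {R : realType} {n : nat} (g : bfun n) (p : R) :
  monotone_bfun g -> g [ffun=> true] = true -> ~ dictator g ->
  interior_fixed_point (expectation_of g) p ->
  derive1 (expectation_of g : R -> R) 1 = 0.
Proof.
move=> mg g1 ndict fixp; rewrite margulis_russo big1 // => i _.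
rewrite -[1 : R]/((true : nat)%:R) !expectation_endpoint /=.
have -> : set_coord i true [ffun=> true] = [ffun=> true].
  by apply/ffunP => j; rewrite !ffunE if_same.
rewrite g1; case gi : (g _); first by rewrite subrr.
case: (no_fixed_point_comparable g i p ndict _ fixp); right => w.
apply: contraFT gi; rewrite negb_imply => /andP[gw wi].
have := monotone_le g w _ mg; move/(_ (set_coord i false [ffun=> true])).
rewrite gw; apply=> j; rewrite !ffunE; case: eqP => [->|_]; last exact: implybT.
by rewrite (negbTE wi).
Qed.

(** * Existence and uniqueness of fixed points of polynomials *)

(** The factors X and X - 1 of P - X account for the fixed points 0 and 1.  The
    bounds on the derivatives give the cofactor opposite signs there, so that it
    has a root strictly between, without any local analysis of P near 0 and
    1. *)
Lemma exists_fixed_point_horner {R : rcfType} (P : {poly R}) :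
  P.[0] = 0 -> P.[1] = 1 -> P^`().[0] < 1 -> P^`().[1] < 1 ->
  exists p, 0 < p < 1 /\ P.[p] = p.
Proof.
move=> P0 P1 dP0 dP1.
have /factor_theorem[Q1 Q1E] : root (P - 'X) 0 by rewrite /root !hornerE P0 subrr.
have /factor_theorem[Q QE] : root Q1 1.
  have := congr1 (horner^~ 1) Q1E; rewrite /root !hornerE P1 !subrr subr0 mulr1.
  by move=> <-.
have PE : P = 'X + Q * ('X - 1) * 'X.
  by rewrite -[P](subrK 'X) Q1E QE subr0 addrC.
(* P' at 0 is 1 - Q.[0], and at 1 it is 1 + Q.[1]. *)
have dPE x : P^`().[x] = 1 + (Q^`().[x] * (x - 1) + Q.[x]) * x + Q.[x] * (x - 1).
  by rewrite PE !poly.derivE !hornerE /=; ring.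
have Q0 : 0 < Q.[0] by move: dP0; rewrite dPE; lra.
have Q1' : Q.[1] < 0 by move: dP1; rewrite dPE; lra.
have sgn : (- Q).[0] <= 0 <= (- Q).[1] by rewrite !hornerE; apply/andP; split; lra.
have [p /andP[p0 p1]] := @poly_ivt _ (- Q) 0 1 ler01 sgn.
rewrite rootN => /eqP Qp; exists p; split; last by rewrite PE !hornerE Qp; ring.
rewrite !lt_neqAle p0 p1 !andbT; apply/andP; split; apply/eqP => pE.
  by move: Qp Q0; rewrite -pE => ->; rewrite ltxx.
by move: Qp Q1'; rewrite pE => ->; rewrite ltxx.
Qed.

(** The odds ratio N / D of P.[x] against x equals 1 exactly at the interior
    fixed points.  Two of them would give, by Rolle, a critical point c of the
    ratio, but the numerator N' D - N D' of its derivative is the gap of P, which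
    is positive. *)
Lemma interior_fixed_point_unique {R : realType} (P : {poly R}) (a b : R) :
  (forall p : R, 0 < p < 1 -> 0 < P.[p] < 1) ->
  (forall p : R, 0 < p < 1 -> 0 < poincare_gap (horner P) p) ->
  interior_fixed_point (horner P) a -> interior_fixed_point (horner P) b ->
  a = b.
Proof.
move=> Poo gap_gt0.
wlog ltab : a b / a < b.
  by move=> th fixa fixb; case: (ltgtP a b) => // lt; [|apply/esym]; exact: th.
move=> [/andP[a0 a1] Pa] [/andP[b0 b1] Pb]; exfalso.
pose N : {poly R} := P * (1 - 'X); pose D : {poly R} := (1 - P) * 'X.
have D0 (x : R) : 0 < x < 1 -> D.[x] != 0.
  move=> x01; have /andP[Px0 Px1] := Poo x x01; have /andP[x0 _] := x01.
  by rewrite /D !hornerE mulf_neq0 // gt_eqF // subr_gt0.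
pose F (x : R) : R := N.[x] * D.[x]^-1.
pose F' (x : R) : R := (N^`().[x] * D.[x] - N.[x] * D^`().[x]) / D.[x] ^+ 2.
have dF (x : R) : 0 < x < 1 -> is_derive x 1 F (F' x).
  move=> x01.
  have dN : is_derive x 1 (horner N) N^`().[x].
    by apply: DeriveDef; rewrite ?derivE ?derive1E //; exact: derivable_horner.
  have dD : is_derive x 1 (horner D) D^`().[x].
    by apply: DeriveDef; rewrite ?derivE ?derive1E //; exact: derivable_horner.
  have dV := is_deriveV (D0 x x01) dD.
  apply: is_derive_eq (is_deriveM dN dV) _.
  rewrite /F' /GRing.scale /=.
  have := D0 x x01; set d := D.[x]; set d' := D^`().[x] => dn0.
  by field.
have F1 (x : R) : 0 < x < 1 -> P.[x] = x -> F x = 1.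
  by move=> x01 Px; rewrite /F (_ : N.[x] = D.[x]) ?divff ?D0 // !hornerE Px mulrC.
have inab (x : R) : x \in `[a, b] -> 0 < x < 1.
  rewrite in_itv /= => /andP[ax xb].
  by rewrite (lt_le_trans a0 ax) (le_lt_trans xb b1).
have Fab : F a = F b by rewrite !F1 ?a0 ?b0.
have [| |c cab dFc] := @Rolle R F a b ltab _ _ Fab.
- by move=> x /subset_itv_oo_cc/inab/dF[].
- by apply: derivable_within_continuous => x /inab/dF[].
have c01 := inab c (subset_itv_oo_cc cab).
have /eqP : F' c = 0 by case: (dF c c01) => _ <-; case: dFc.
rewrite mulf_eq0 invr_eq0 sqrf_eq0 (negbTE (D0 c c01)) orbF => /eqP num0.
have := gap_gt0 c c01; rewrite /poincare_gap -derivE.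
suff -> : c * (1 - c) * P^`().[c] - P.[c] * (1 - P.[c]) =
  N^`().[c] * D.[c] - N.[c] * D^`().[c] by rewrite num0 ltxx.
by rewrite !poly.derivE !hornerE /=; ring.
Qed.

Theorem theorem11p1 (R : realType) (n : nat) (g : bfun n)
    (g_mono : monotone_bfun g) (g_nontriv : nontrivial_bfun g)
    (g_not_dict : ~ dictator g) :
  let E : R -> R := expectation_of g in
  ((exists p : R, interior_fixed_point E p) <->
     (derive1 E 0 = 0 /\ derive1 E 1 = 0)) /\
  ((exists p : R, interior_fixed_point E p) ->
     exists p0 : R,
       [/\ interior_fixed_point E p0,
           forall q : R, interior_fixed_point E q -> q = p0
         & 1 < derive1 E p0]).
Proof.
move=> E; have [g0 g1] := g_nontriv.
have [P PE] := expectation_polynomial (fun w => (g w)%:R : R).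
have {}PE : E = horner P := PE.
have E0 : E 0 = 0.
  by have := expectation_endpoint (fun w => (g w)%:R : R) false; rewrite g0.
have E1 : E 1 = 1.
  by have := expectation_endpoint (fun w => (g w)%:R : R) true; rewrite g1.
have gap_gt0 p : 0 < p < 1 -> 0 < poincare_gap E p by exact: poincare_gap_gt0.
have Eoo p : 0 < p < 1 -> 0 < E p < 1 by exact: expectation_of_oo.
split; first split=> [[p fixp]|[dE0 dE1]].
- split; first exact: derive_at0_fixed_point fixp.
  exact: derive_at1_fixed_point fixp.
- rewrite PE in E0 E1 dE0 dE1 *; apply: exists_fixed_point_horner => //.
    by rewrite derivE dE0 ltr01.
  by rewrite derivE dE1 ltr01.
move=> [p fixp]; exists p; split=> // [q fixq|].
  rewrite PE in gap_gt0 Eoo fixp fixq.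
  exact: interior_fixed_point_unique Eoo gap_gt0 fixq fixp.
have [p01 Ep] := fixp; have := gap_gt0 p p01.
(* At a fixed point the gap is p (1 - p) (h'(p) - 1). *)
rewrite /poincare_gap Ep -{2}[p * (1 - p)]mulr1 -mulrBr.
by case/andP: p01 => p0 p1; rewrite pmulr_rgt0 ?subr_gt0 // mulr_gt0 ?subr_gt0.
Qed.
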